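(* Let $n\ge 2$ be an integer and let $q>n$ be a real number. Then there exist smooth strictly convex bodies $K,L\subset\mathbb{R}^n$ containing the origin in their interiors such that $$\widetilde V_q(K+L)^{\frac1q}<\widetilde V_q(K)^{\frac1q}+\widetilde V_q(L)^{\frac1q}.$$
   Context: A convex body in $\mathbb{R}^n$ is a compact convex set with nonempty interior. For a convex body $K$ with the origin in its interior, its radial function is $\rho_K(u)=\max\{\lambda>0:\lambda u\in K\}$, $u\in\mathbb{S}^{n-1}$, and for real $q$ the $q$-th dual quermassintegral is $$\widetilde V_q(K)=\frac1n\int_{\mathbb{S}^{n-1}}\rho_K(u)^q\,du,$$ where $du$ is spherical Lebesgue measure on the unit sphere. For $q>0$, equivalently $\widetilde V_q(K)=\frac qn\int_K|x|^{q-n}\,dx$. $K+L=\{x+y:x\in K,y\in L\}$ is the Minkowski sum. ''Smooth'' means with $C^\infty$ boundary. *)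

(* Defs.v *)
From HB Require Import structures.
From mathcomp Require Import all_boot all_order all_algebra.
From mathcomp Require Import all_classical all_reals all_analysis.
From mathcomp Require Import measurable_realfun.

Set Implicit Arguments.
Unset Strict Implicit.
Unset Printing Implicit Defensive.

Import Order.TTheory GRing.Theory Num.Theory.
Import numFieldNormedType.Exports.

Local Open Scope classical_set_scope.
Local Open Scope ring_scope.

(* R^n is 'rV[R]_n. Its library norm `|x| is the sup norm, which is only used
   through the topology it induces; lengths are measured with enorm. *)
Definition enorm (R : realType) (n : nat) (x : 'rV[R]_n) : R :=
  Num.sqrt (\sum_(i < n) x 0 i ^+ 2).

Definition minkowski_sum (R : realType) (n : nat) (K L : set 'rV[R]_n) :
  set 'rV[R]_n := [set x + y | x in K & y in L].

Definition convex_body (R : realType) (n : nat) (K : set 'rV[R]_n) : Prop :=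
  [/\ compact K, convex_set K & K° !=set0].

Definition strictly_convex (R : realType) (n : nat) (K : set 'rV[R]_n) : Prop :=
  forall (x y : 'rV[R]_n) (t : R), K x -> K y -> x != y -> 0 < t -> t < 1 ->
    K° (t *: x + (1 - t) *: y).

Definition bd (R : realType) (n : nat) (K : set 'rV[R]_n) : set 'rV[R]_n :=
  closure K `\` K°.

Definition partial (R : realType) (n : nat) (i : 'I_n) (f : 'rV[R]_n -> R) :
  'rV[R]_n -> R := 'D_(delta_mx 0 i) f.

Definition iter_partial (R : realType) (n : nat) (s : seq 'I_n)
  (f : 'rV[R]_n -> R) : 'rV[R]_n -> R := foldr (@partial R n) f s.

(* f is C^oo on the open set U: its partial derivatives of all orders exist
   and are continuous on U (s = [::] gives f itself). *)
Definition smooth_on (R : realType) (n : nat) (U : set 'rV[R]_n)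
    (f : 'rV[R]_n -> R) : Prop :=
  forall (s : seq 'I_n) (x : 'rV[R]_n), U x ->
    {for x, continuous (iter_partial s f)} /\
    (forall i : 'I_n, derivable (iter_partial s f) x (delta_mx 0 i)).

(* The boundary is an embedded C^oo hypersurface: near each of its points it is
   a level set of a C^oo function whose gradient at that point is nonzero. *)
Definition smooth_boundary (R : realType) (n : nat) (K : set 'rV[R]_n) : Prop :=
  forall x : 'rV[R]_n, bd K x ->
    exists (U : set 'rV[R]_n) (f : 'rV[R]_n -> R),
      [/\ open U, U x, smooth_on U f,
          exists i : 'I_n, partial i f x != 0 &
          bd K `&` U = [set y | f y = 0] `&` U].

(* The sup is a max when K is a convex body with 0 in its interior, u != 0. *)
Definition radial (R : realType) (n : nat) (K : set 'rV[R]_n) (u : 'rV[R]_n) :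
  R := sup [set lambda : R | 0 < lambda /\ K (lambda *: u)].

(* The library has no measurable structure on 'rV[R]_n, whereas n-tuples carry
   the product of the Borel sigma-algebras. Measures on R^n are therefore put
   on n-tuples, and to_row identifies n-tuples with row vectors. *)
Definition to_row (R : realType) (n : nat) (t : n.-tuple R) : 'rV[R]_n :=
  \row_(i < n) tnth t i.

Definition tcons (R : realType) (n : nat)
  (p : measurableTypeR R * n.-tuple R) : n.+1.-tuple R := [tuple of p.1 :: p.2].

Lemma measurable_tcons (R : realType) (n : nat) :
  measurable_fun [set: measurableTypeR R * n.-tuple R] (@tcons R n).
Proof. exact: (measurable_cons measurable_fst measurable_snd). Qed.

Section lebesgue_succ.
Local Open Scope ereal_scope.
Context (R : realType) (n : nat).
Variable mu : {sigma_finite_measure set (n.-tuple R) -> \bar R}.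

Definition lebesgue_succ : set (n.+1.-tuple R) -> \bar R :=
  pushforward (@lebesgue_measure R \x mu) (@tcons R n).

Let lebesgue_succ0 : lebesgue_succ set0 = 0.
Proof. by rewrite /lebesgue_succ /pushforward preimage_set0 measure0. Qed.

Let lebesgue_succ_ge0 A : 0 <= lebesgue_succ A.
Proof. exact: (measure_ge0 (lebesgue_measure \x mu)%E). Qed.

Let lebesgue_succ_sigma_additive : semi_sigma_additive lebesgue_succ.
Proof.
move=> F mF tF mUF; rewrite /lebesgue_succ /pushforward preimage_bigcup.
have mt A : measurable A -> measurable (@tcons R n @^-1` A).
  by move=> mA; rewrite -[X in measurable X]setTI; exact: measurable_tcons.
apply: measure_semi_sigma_additive.
- by move=> k; exact: mt.
- apply/trivIsetP => /= i j _ _ ij; rewrite -preimage_setI.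
  by move/trivIsetP : tF => /(_ _ _ _ _ ij) ->//; rewrite preimage_set0.
- by rewrite -preimage_bigcup; exact: mt.
Qed.

HB.instance Definition _ := isMeasure.Build _ _ _ lebesgue_succ
  lebesgue_succ0 lebesgue_succ_ge0 lebesgue_succ_sigma_additive.

Let lebesgue_succ_sigma_finite : sigma_finite setT lebesgue_succ.
Proof.
have /sigma_finiteP[F [TF ndF Foo]] := sigma_finiteT (@lebesgue_measure R).
have /sigma_finiteP[G [TG ndG Goo]] := sigma_finiteT mu.
pose g (t : n.+1.-tuple R) : measurableTypeR R * n.-tuple R :=
  (thead t, [tuple of behead t]).
have mg : measurable_fun setT g.
  apply/measurable_fun_pair; first exact: measurable_tnth.
  exact: measurable_behead.
have gK p : g (tcons p) = p.
  by case: p => a b; rewrite /g /tcons theadE; congr pair; exact: val_inj.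
exists (fun k => g @^-1` (F k `*` G k)).
  rewrite -preimage_bigcup (_ : \bigcup_k _ = setT) ?preimage_setT//.
  apply/seteqP; split => // -[x y] _.
  have : [set: measurableTypeR R] x by [].
  have : [set: n.-tuple R] y by [].
  rewrite TF TG => -[k _ Gky] [j _ Fjx]; exists (maxn j k) => //; split.
  - by move: x Fjx; exact/subsetPset/ndF/leq_maxl.
  - by move: y Gky; exact/subsetPset/ndG/leq_maxr.
move=> k; have [mF Fkoo] := Foo k; have [mG Gkoo] := Goo k; split.
  by rewrite -[X in measurable X]setTI; apply: mg => //; exact: measurableX.
rewrite /lebesgue_succ /pushforward -comp_preimage.
rewrite (_ : g \o _ = id) ?preimage_id; last exact/funext.
by rewrite product_measure1E// lte_mul_pinfty// ge0_fin_numE.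
Qed.

HB.instance Definition _ := Measure_isSigmaFinite.Build _ _ _ lebesgue_succ
  lebesgue_succ_sigma_finite.

End lebesgue_succ.

(* n-dimensional Lebesgue measure (on Borel sets) *)
Fixpoint lebesgue_tuple (R : realType) (n : nat) :
    {sigma_finite_measure set (n.-tuple R) -> \bar R} :=
  match n with
  | 0 => @dirac _ (0.-tuple R) [tuple] R
  | m.+1 => lebesgue_succ (lebesgue_tuple R m)
  end.

Definition sphere_proj (R : realType) (n : nat) (t : n.-tuple R) : n.-tuple R :=
  [tuple (enorm (to_row t))^-1 * tnth t i | i < n].

Definition unit_sphere (R : realType) (n : nat) : set (n.-tuple R) :=
  [set t | enorm (to_row t) = 1].

Definition punctured_ball (R : realType) (n : nat) : set (n.-tuple R) :=
  [set t | 0 < enorm (to_row t) <= 1].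

Arguments unit_sphere : clear implicits.
Arguments punctured_ball : clear implicits.

Lemma measurable_enorm (R : realType) (n : nat) :
  measurable_fun [set: n.-tuple R] (fun t => enorm (to_row t)).
Proof.
have msqrt := continuous_measurable_fun (@sqrt_continuous R).
rewrite /enorm; apply: (measurableT_comp msqrt).
apply: measurable_sum => i.
under eq_fun do rewrite mxE.
by apply: measurable_funX; exact: measurable_tnth.
Qed.

Lemma measurable_sphere_proj (R : realType) (n : nat) :
  measurable_fun [set: n.-tuple R] (@sphere_proj R n).
Proof.
apply/measurable_fun_tnthP => i.
rewrite (_ : _ \o _ =
    fun t : n.-tuple R => (enorm (to_row t) `^ (-1)) * tnth t i).
  apply: measurable_funM; last exact: measurable_tnth.
  exact: (measurableT_comp (measurable_powR (-1)) (@measurable_enorm R n)).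
apply/funext => t /=; rewrite tnth_mktuple powR_inv1//; exact: sqrtr_ge0.
Qed.

Lemma measurable_punctured_ball (R : realType) (n : nat) :
  measurable (punctured_ball R n).
Proof.
rewrite (_ : punctured_ball _ _ =
    (fun t : n.-tuple R => enorm (to_row t)) @^-1` `]0, 1]).
  by rewrite -[X in measurable X]setTI; exact: measurable_enorm.
by apply/seteqP; split => t /=; rewrite in_itv.
Qed.

Section sphere_measure.
Local Open Scope ereal_scope.
Context (R : realType) (n : nat).

(* Spherical Lebesgue measure of A: n times the n-dimensional volume of the
   cone {r u : 0 < r <= 1, u in A}, for A a Borel subset of the unit sphere. *)
Definition sphere_measure (A : set (n.-tuple R)) : \bar R :=
  n%:R%:E *
  lebesgue_tuple R n (punctured_ball R n `&` (@sphere_proj R n) @^-1` A).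

Let mcone A : measurable A ->
  measurable (punctured_ball R n `&` (@sphere_proj R n) @^-1` A).
Proof.
move=> mA; apply: measurableI; first exact: measurable_punctured_ball.
by rewrite -[X in measurable X]setTI; exact: measurable_sphere_proj.
Qed.

Let sphere_measure0 : sphere_measure set0 = 0.
Proof. by rewrite /sphere_measure preimage_set0 setI0 measure0 mule0. Qed.

Let sphere_measure_ge0 A : 0 <= sphere_measure A.
Proof. by rewrite /sphere_measure mule_ge0// lee_fin. Qed.

Let sphere_measure_sigma_additive : semi_sigma_additive sphere_measure.
Proof.
move=> F mF tF mUF; rewrite /sphere_measure preimage_bigcup setI_bigcupr.
under eq_fun do rewrite -ge0_sume_distrr//.
apply: cvgeZl => //; apply: measure_semi_sigma_additive.
- by move=> k; exact: mcone.
- apply/trivIsetP => /= i j _ _ ij; rewrite setIACA -preimage_setI.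
  by move/trivIsetP : tF => /(_ _ _ _ _ ij) ->//; rewrite preimage_set0 setI0.
- by rewrite -setI_bigcupr -preimage_bigcup; exact: mcone.
Qed.

HB.instance Definition _ := isMeasure.Build _ _ _ sphere_measure
  sphere_measure0 sphere_measure_ge0 sphere_measure_sigma_additive.

End sphere_measure.
Arguments sphere_measure : clear implicits.

Definition dual_quermassintegral (R : realType) (n : nat) (q : R)
    (K : set 'rV[R]_n) : R :=
  n%:R^-1 * \int[sphere_measure R n]_(u in unit_sphere R n)
              (radial K (to_row u) `^ q).

(* Main.v *)
(* K and L are the unit balls centered at c = e e_i and at - c, for a small e > 0,
   so that K + L is the centered ball of radius 2, with V_q(K + L)^(1/q) =
   2 V_q(B)^(1/q), B being the centered unit ball. As V_q(K) = V_q(L) by symmetry,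
   it remains to see that V_q(K) > V_q(B). The radial function of K is
   rho(u) = e u_i + sqrt(1 - e^2 + e^2 u_i^2), and averaging over u and - u gives
   (rho(u)^q + rho(- u)^q) / 2 = 1 + q e^2 (q u_i^2 - 1) / 2 + O(e^3). Since
   the sum over i of the integrals of u_i^2 is sigma(S), some i makes the integral
   of u_i^2 at least sigma(S) / n > sigma(S) / q, and for this i the term of
   order e^2 is positive. *)
Require Import Defs.
From mathcomp Require Import all_boot all_order all_algebra.
From mathcomp Require Import all_classical all_reals all_analysis.
From mathcomp Require Import measurable_realfun.
From mathcomp Require Import ring lra.

Set Implicit Arguments.
Unset Strict Implicit.
Unset Printing Implicit Defensive.

Import Order.TTheory GRing.Theory Num.Theory.
Import numFieldNormedType.Exports.

Local Open Scope classical_set_scope.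
Local Open Scope ring_scope.

(** * Elementary bounds on exponentials, logarithms and powers *)

(** As [e^y + e^(-y) - 2 = (e^y - 1)^2 e^(-y)], it suffices to use [e^x >= 1 + x] at [x = y] and at
    [x = - y]. *)
Lemma expR_addN_ge (R : realType) (y : R) : 0 <= y ->
  2 + y ^+ 2 * (1 - y) <= expR y + expR (- y).
Proof.
move=> y0; have h1 := expR_ge1Dx y; have h2 := expR_ge1Dx (- y).
have E : expR (- y) * expR y = 1 by rewrite mulrC expRxMexpNx_1.
have -> : expR y + expR (- y) = 2 + (expR y - 1) ^+ 2 * expR (- y).
  rewrite (_ : _ * _ = expR (- y) * expR y * (expR y - 2) + expR (- y));
    last by ring.
  by rewrite E; ring.
rewrite lerD2l; have sq : y ^+ 2 <= (expR y - 1) ^+ 2.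
  by rewrite ler_sqr ?nnegrE; lra.
apply: (@le_trans _ _ (y ^+ 2 * expR (- y))).
  by rewrite ler_wpM2l ?sqr_ge0//; lra.
by rewrite ler_wpM2r// expR_ge0.
Qed.

Lemma ln_ge1BV (R : realType) (y : R) : 0 < y -> 1 - y^-1 <= ln y.
Proof.
move=> y0; have yV0 : 0 < y^-1 by rewrite invr_gt0.
have := @le_ln1Dx R (y^-1 - 1).
rewrite (addrC 1) subrK lnV ?posrE//.
by move=> /(_ ltac:(lra)); lra.
Qed.

(** Quantitative form of the expansion of [rho(u)^q + rho(-u)^q], with [a] standing for [|u_i|]. The
    first factor bounds [(1 - e^2)^(q/2)], the second the remaining sum of two opposite
    exponentials. The smallness of [e] makes both bounds nonnegative, so that they can be
    multiplied. *)
Lemma powR_pair_ge (R : realType) (q e a : R) :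
  2 <= q -> 0 < e -> (8 + 8 * q) * e <= 1 -> 0 <= a <= 1 ->
  (1 - q / 2 * e ^+ 2 * (1 + 2 * e)) *
    (2 + q ^+ 2 * e ^+ 2 * a ^+ 2 * (1 - 2 * (1 + q) * e)) <=
  (Num.sqrt (1 - e ^+ 2 + e ^+ 2 * a ^+ 2) + e * a) `^ q +
  (Num.sqrt (1 - e ^+ 2 + e ^+ 2 * a ^+ 2) - e * a) `^ q.
Proof.
move=> q2 e0 qe /andP[a0 a1].
set w := Num.sqrt _.
have e14 : e <= 1 / 8 by nra.
have e2 : e ^+ 2 <= e / 8 by rewrite expr2; nra.
have e20 : 0 <= e ^+ 2 by rewrite sqr_ge0.
set b := e * a; have b0 : 0 <= b by rewrite mulr_ge0// ltW.
have be : b <= e by rewrite /b ger_pMr.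
set k := 1 - e ^+ 2.
have k0 : 0 < k by rewrite /k; lra.
have wE : w ^+ 2 = k + b ^+ 2.
  rewrite /w -exprMn -/b -/k sqr_sqrtr//.
  by rewrite addr_ge0// ?sqr_ge0// ltW.
have w0 : 0 <= w by exact: sqrtr_ge0.
have b2 : b ^+ 2 <= e ^+ 2 by rewrite ler_sqr ?nnegrE// ltW.
have w1 : w <= 1.
  by rewrite -(@ler_sqr _ w 1) ?nnegrE// wE expr1n /k; lra.
have we : 1 - e <= w.
  by rewrite -(@ler_sqr _ _ w) ?nnegrE//; [rewrite wE /k; nra|lra].
set P := w + b; set M := w - b.
have bPM : b = (P - M) / 2 by rewrite /P /M; field.
have M0 : 1 / 2 <= M by rewrite /M; lra.
have P0 : 0 < P by rewrite /P; lra.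
have PM : P * M = k.
  by rewrite /P /M; transitivity (w ^+ 2 - b ^+ 2); [ring|rewrite wE; ring].
have Mpos : 0 < M by lra.
(* P and M are [sqrt k] times [e^th] and [e^(- th)], so the sum to be bounded is
   [k^(q/2) (e^(q th) + e^(- q th))], where [th] is close to [b]. *)
set th := (ln P - ln M) / 2.
have lk : ln k = ln P + ln M by rewrite -PM lnM ?posrE.
have EP : P `^ q = k `^ (q / 2) * expR (q * th).
  by rewrite /powR (gt_eqF P0) (gt_eqF k0) -expRD lk /th; congr expR; field.
have EM : M `^ q = k `^ (q / 2) * expR (- (q * th)).
  by rewrite /powR (gt_eqF Mpos) (gt_eqF k0) -expRD lk /th; congr expR; field.
have lPM : ln (P / M) = ln P - ln M by rewrite ln_div ?posrE.
have PM0 : 0 < P / M by rewrite divr_gt0.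
(* [ln x >= 1 - 1/x] at [x = P / M] gives [th >= b / P], and [P <= 1 + e]. *)
have thlo : b * (1 - e) <= th.
  have := ln_ge1BV PM0; rewrite lPM invf_div.
  have -> : 1 - M / P = 2 * (b / P).
    by rewrite bPM; field; rewrite gt_eqF.
  have : b * (1 - e) <= b / P.
    by rewrite ler_wpM2l// -[X in _ <= X]div1r ler_pdivlMr// /P; nra.
  by rewrite /th; lra.
(* [ln x <= x - 1] at [x = P / M] gives [th <= b / M], and [M >= 1/2]. *)
have thhi : th <= 2 * e.
  have := @le_ln1Dx R (P / M - 1); rewrite (addrC 1) subrK lPM => /(_ ltac:(lra)).
  have -> : P / M - 1 = 2 * (b / M).
    by rewrite bPM; field; rewrite gt_eqF.
  have : b / M <= 2 * e.
    by rewrite ler_pdivrMr//; nra.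
  by rewrite /th; lra.
have th0 : 0 <= th by apply: le_trans thlo; rewrite mulr_ge0//; lra.
have y0 : 0 <= q * th by rewrite mulr_ge0//; lra.
rewrite EP EM -mulrDr.
apply: ler_pM.
- have : (q / 2 * e ^+ 2) * (1 + 2 * e) <= 1 by nra.
  lra.
- have h1 : 0 <= q ^+ 2 * e ^+ 2 * a ^+ 2 by rewrite -!exprMn sqr_ge0.
  have h2 : 0 <= 1 - 2 * (1 + q) * e by nra.
  by rewrite addr_ge0// mulr_ge0.
(* [k^(q/2) = expR (q/2 * ln k) >= 1 + q/2 * ln k >= 1 + q/2 * (1 - k^-1)]. *)
- rewrite /powR gt_eqF//; apply: le_trans (expR_ge1Dx _).
  have kV : k^-1 <= 1 + e ^+ 2 * (1 + 2 * e).
    rewrite -[X in X <= _]mul1r ler_pdivrMr// /k; nra.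
  have := ln_ge1BV k0; nra.
- apply: le_trans (expR_addN_ge y0); rewrite lerD2l.
  rewrite (_ : _ * a ^+ 2 = (q * b) ^+ 2); last by rewrite /b; ring.
  have -> : (q * th) ^+ 2 * (1 - q * th) = (th ^+ 2 * (1 - q * th)) * q ^+ 2 by ring.
  have -> : (q * b) ^+ 2 * (1 - 2 * (1 + q) * e) =
    (b ^+ 2 * (1 - 2 * (1 + q) * e)) * q ^+ 2 by ring.
  rewrite ler_wpM2r ?sqr_ge0//.
  (* The square uses the lower bound on [th], the other factor the upper one. To first order
     [(1 - e)^2] loses [2 e] and [1 - 2 q e] loses [2 q e], whence the constant [2 (1 + q)]. *)
  apply: (@le_trans _ _ ((b * (1 - e)) ^+ 2 * (1 - 2 * q * e))).
    rewrite (_ : (b * (1 - e)) ^+ 2 * _ = b ^+ 2 * ((1 - e) ^+ 2 * (1 - 2 * q * e))); last by ring.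
    rewrite ler_wpM2l ?sqr_ge0//.
    have : 0 <= e * (e * (1 - 2 * q * e)) by rewrite !mulr_ge0 ?ltW//; nra.
    nra.
  apply: ler_pM; rewrite ?sqr_ge0//; first by nra.
    by rewrite ler_sqr ?nnegrE// mulr_ge0//; lra.
  nra.
Qed.

(** * Euclidean balls: interior, strict convexity, smoothness, Minkowski sum *)

(** The square of [enorm]; it keeps the arguments about balls polynomial. *)
Definition sqnorm (R : realType) (n : nat) (x : 'rV[R]_n) : R :=
  \sum_(i < n) x 0 i ^+ 2.

Definition eball (R : realType) (n : nat) (c : 'rV[R]_n) (r : R) : set 'rV[R]_n :=
  [set x | sqnorm (x - c) <= r ^+ 2].

Section euclidean_ball.
Context (R : realType) (n : nat).
Implicit Types (x y c : 'rV[R]_n) (r t : R).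

Lemma sqnorm_ge0 x : 0 <= sqnorm x.
Proof. by apply: sumr_ge0 => i _; exact: sqr_ge0. Qed.

Lemma sqnormN x : sqnorm (- x) = sqnorm x.
Proof. by apply: eq_bigr => i _; rewrite mxE sqrrN. Qed.

Lemma sqnormZ t x : sqnorm (t *: x) = t ^+ 2 * sqnorm x.
Proof. by rewrite mulr_sumr; apply: eq_bigr => i _; rewrite mxE exprMn. Qed.

Lemma sqnorm_gt0 x : x != 0 -> 0 < sqnorm x.
Proof.
move=> /rV0Pn[i xi]; rewrite /sqnorm (bigD1 i)//= ltr_pwDl//.
  by rewrite exprn_even_gt0.
by apply: sumr_ge0 => j _; exact: sqr_ge0.
Qed.

(** The subtracted term is the gain that makes balls strictly convex; [t = 1/2] is the parallelogram
    law. *)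
Lemma sqnorm_conv t x y : sqnorm (t *: x + (1 - t) *: y) =
  t * sqnorm x + (1 - t) * sqnorm y - t * (1 - t) * sqnorm (x - y).
Proof.
rewrite !mulr_sumr -big_split/= -sumrB; apply: eq_bigr => i _.
by rewrite !mxE; ring.
Qed.

Lemma sqr_coord_le_sqnorm x i : x 0 i ^+ 2 <= sqnorm x.
Proof.
rewrite /sqnorm (bigD1 i)//= lerDl.
by apply: sumr_ge0 => j _; exact: sqr_ge0.
Qed.

Lemma continuous_sqnormB c : continuous (fun x => sqnorm (x - c)).
Proof.
apply: continuous_big; first exact: add_continuous.
move=> i _ x.
have h : {for x, continuous (fun y : 'rV[R]_n => (y - c) 0 i)}.
  rewrite (_ : (fun _ => _) = (fun y : 'rV[R]_n => y 0 i) - cst (c 0 i)).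
    by apply: continuousB; [exact: coord_continuous|exact: cst_continuous].
  by apply/funext => y; rewrite !mxE.
exact: (continuous_comp h (@exprn_continuous R 2 _)).
Qed.

Lemma eball_interior c r : 0 < r ->
  (eball c r)° = [set x | sqnorm (x - c) < r ^+ 2].
Proof.
move=> r0; apply/seteqP; split => [x xi|x /= xr].
- have := interior_subset xi; rewrite /eball/= le_eqVlt => /orP[/eqP xr|//].
  (* If [x] were interior at distance exactly [r] from [c], a slight push away from [c] would stay
     in the ball, yet it multiplies the distance by [1 + s > 1]. *)
  have cv : (x + s *: (x - c)) @[s --> (0 : R)^'+] --> x.
    apply: cvg_at_right_filter; rewrite -[X in _ --> X]addr0 -(scale0r (x - c)).
    by apply: cvgD; [exact: cvg_cst|apply: cvgZr_tmp; exact: cvg_id].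
  have /cv near_in : nbhs x (eball c r) by [].
  near (0 : R)^'+ => s.
  have s0 : 0 < s by near: s; exact: nbhs_right_gt.
  have : eball c r (x + s *: (x - c)) by near: s.
  rewrite /eball/=; have -> : x + s *: (x - c) - c = (1 + s) *: (x - c).
    by rewrite scalerDl scale1r addrAC.
  rewrite sqnormZ xr ger_pMl ?exprn_gt0// => h.
  by nra.
- have op : open [set x | sqnorm (x - c) < r ^+ 2].
    rewrite (_ : mkset _ = (fun x => sqnorm (x - c)) @^-1` [set z | z < r ^+ 2])//.
    apply: open_comp; last exact: open_lt.
    by move=> *; exact: continuous_sqnormB.
  by move: (x) xr; rewrite -/(_ `<=` _) -(open_subsetE _ op) => y; exact: ltW.
Unshelve. all: by end_near. Qed.

Lemma closed_eball c r : closed (eball c r).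
Proof.
rewrite (_ : eball c r = (fun x => sqnorm (x - c)) @^-1` [set z | z <= r ^+ 2])//.
apply: closed_comp; last exact: closed_le.
by move=> *; exact: continuous_sqnormB.
Qed.

Lemma compact_eball c r : 0 < r -> compact (eball c r).
Proof.
move=> r0; apply: bounded_closed_compact; last exact: closed_eball.
exists (r + `|c|); split; first exact: num_real.
move=> M rM x xr; apply: (le_trans _ (ltW rM)).
rewrite -[x](subrK c) (le_trans (ler_normD _ _))// lerD2r.
rewrite /Num.norm/= mx_normrE; apply: bigmax_le; first exact: ltW.
move=> [i j] _ /=; rewrite (ord1 i) -(@ler_sqr _ _ r) ?nnegrE//; last exact: ltW.
by rewrite real_normK ?num_real//; exact: (le_trans (sqr_coord_le_sqnorm _ j)).
Qed.

Lemma eball_conv c r x y t : eball c r x -> eball c r y -> 0 <= t <= 1 ->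
  sqnorm (t *: x + (1 - t) *: y - c) <=
    r ^+ 2 - t * (1 - t) * sqnorm (x - y).
Proof.
rewrite /eball/= => xr yr /andP[t0 t1].
have -> : t *: x + (1 - t) *: y - c = t *: (x - c) + (1 - t) *: (y - c).
  by apply/rowP => i; rewrite !mxE; ring.
rewrite sqnorm_conv (_ : x - c - (y - c) = x - y); last first.
  by apply/rowP => i; rewrite !mxE; ring.
by rewrite lerD2r; nra.
Qed.

Lemma strictly_convex_eball c r : 0 < r -> strictly_convex (eball c r).
Proof.
move=> r0 x y t xr yr xy t0 t1; rewrite eball_interior//=.
apply: (le_lt_trans (eball_conv xr yr _)); first by rewrite !ltW.
rewrite ltrBlDr ltrDl !mulr_gt0 ?subr_gt0//.
by apply: sqnorm_gt0; rewrite subr_eq0.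
Qed.

Lemma convex_set_eball c r : convex_set (eball c r).
Proof.
move=> x y l; rewrite !inE => xr yr.
have l01 : 0 <= l%:num <= 1 by rewrite ge0 le1.
apply: (le_trans (eball_conv xr yr l01)).
by rewrite gerBl !mulr_ge0 ?sqnorm_ge0// subr_ge0.
Qed.

Lemma convex_body_eball c r : 0 < r -> convex_body (eball c r).
Proof.
move=> r0; split; [exact: compact_eball|exact: convex_set_eball|].
exists c; rewrite eball_interior//= subrr /sqnorm big1 ?exprn_gt0//.
by move=> i _; rewrite mxE expr0n.
Qed.

(* Quadratic polynomials of this shape are closed under [partial], which gives
   smoothness by induction on the sequence of derivatives. *)
Definition quadratic (a : R) (b c : 'rV[R]_n) (d : R) x : R :=
  a * sqnorm (x - c) + \sum_(k < n) b 0 k * x 0 k + d.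

Lemma is_derive_coord x v k : is_derive x v (fun y : 'rV[R]_n => y 0 k) (v 0 k).
Proof.
have D : derivable (id : 'rV[R]_n -> 'rV[R]_n) x v by exact: derivable_id.
have /derivable_mxP Dk := D.
apply: DeriveDef; first exact: (Dk 0 k).
by have := derive_mx D; rewrite derive_id => /(congr1 (fun M : 'rV_n => M 0 k)); rewrite mxE.
Qed.

Lemma is_derive_quadratic a b c d x i :
  is_derive x (delta_mx 0 i) (quadratic a b c d)
    (quadratic 0 (2 * a *: delta_mx 0 i) c (b 0 i - 2 * a * c 0 i) x).
Proof.
have Dk k : is_derive x (delta_mx 0 i)
    (fun y : 'rV[R]_n => a * (y 0 k - c 0 k) ^+ 2 + b 0 k * y 0 k)
    ((k == i)%:R * (2 * a * (x 0 k - c 0 k) + b 0 k)).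
  have Hk := is_derive_coord x (delta_mx 0 i) k.
  apply: is_derive_eq; rewrite !mxE eqxx/= /GRing.scale/=; ring.
(* Splitting into functions of a single coordinate leaves only the [i]-th summand with a nonzero
   derivative. *)
have E : quadratic a b c d = (\sum_(k < n)
    (fun y : 'rV[R]_n => a * (y 0 k - c 0 k) ^+ 2 + b 0 k * y 0 k)) + cst d.
  apply/funext => y; rewrite /quadratic /sqnorm mulr_sumr -big_split/=.
  rewrite fctE fct_sumE; congr (_ + _); apply: eq_bigr => k _.
  by rewrite !mxE.
rewrite E; apply: is_derive_eq; rewrite addr0 /quadratic mul0r add0r.
rewrite (bigD1 i)//= big1 ?addr0; last by move=> k /negbTE ->; rewrite mul0r.
rewrite (bigD1 i)//= big1 ?addr0; last first.
  by move=> k /negbTE ki; rewrite !mxE eqxx ki mulr0 mul0r.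
by rewrite !mxE !eqxx/=; ring.
Qed.

Lemma continuous_quadratic a b c d : continuous (quadratic a b c d).
Proof.
move=> x.
have h1 : {for x, continuous (cst a * (fun y : 'rV[R]_n => sqnorm (y - c)))}.
  by apply: continuousM; [exact: cst_continuous|exact: continuous_sqnormB].
have h2 : continuous (fun y : 'rV[R]_n => \sum_(k < n) b 0 k * y 0 k).
  apply: continuous_big; first exact: add_continuous.
  move=> i _ z; apply: (@continuousM _ _ (cst (b 0 i)) (fun y : 'rV[R]_n => y 0 i)).
    exact: cst_continuous.
  exact: coord_continuous.
exact: (continuousD (continuousD h1 (h2 x)) (@cst_continuous _ _ d x)).
Qed.

Lemma smooth_quadratic a b c d : smooth_on setT (quadratic a b c d).
Proof.
move=> s x _; have [a' [b' [d' ->]]] : exists a' b' d',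
    iter_partial s (quadratic a b c d) = quadratic a' b' c d'.
  elim: s => [|i s [a' [b' [d' IH]]]]; first by exists a, b, d.
  exists 0, (2 * a' *: delta_mx 0 i), (b' 0 i - 2 * a' * c 0 i).
  rewrite /iter_partial/= -/(iter_partial s _) IH; apply/funext => y.
  by rewrite /partial; have Dy := is_derive_quadratic a' b' c d' y i; exact: derive_val.
split; first exact: continuous_quadratic.
by move=> i; have Dx := is_derive_quadratic a' b' c d' x i; exact: ex_derive.
Qed.

(** One global equation, [|x - c|^2 - r^2 = 0], serves at every boundary point; its gradient
    [2 (x - c)] does not vanish there because [r > 0]. *)
Lemma smooth_boundary_eball c r : 0 < r -> smooth_boundary (eball c r).
Proof.
move=> r0.
have bdE y : bd (eball c r) y <-> quadratic 1 0 c (- r ^+ 2) y = 0.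
  rewrite /bd eball_interior// -(closure_id _).1; last exact: closed_eball.
  rewrite /quadratic mul1r big1 ?addr0; last by move=> k _; rewrite mxE mul0r.
  rewrite /eball/=; split => [[le /negP]|/eqP].
    rewrite -leNgt => ge; apply/eqP; rewrite subr_eq0; apply/eqP/le_anti.
    by rewrite le ge.
  by rewrite subr_eq0 => /eqP ->; rewrite ltxx.
move=> x xb; exists setT, (quadratic 1 0 c (- r ^+ 2)); split => //.
- exact: openT.
- exact: smooth_quadratic.
- have /rV0Pn[i xi] : x - c != 0.
    apply/eqP => xc; move/bdE : xb; rewrite /quadratic mul1r xc.
    rewrite big1 ?addr0; last by move=> k _; rewrite mxE mul0r.
    rewrite /sqnorm big1; last by move=> k _; rewrite mxE expr0n.
    by rewrite add0r => /eqP; rewrite oppr_eq0 expf_eq0/= gt_eqF.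
  exists i; rewrite /partial.
  have Dx := is_derive_quadratic 1 0 c (- r ^+ 2) x i.
  rewrite derive_val /quadratic mul0r add0r (bigD1 i)//= big1 ?addr0; last first.
    by move=> k /negbTE ki; rewrite !mxE eqxx ki mulr0 mul0r.
  rewrite !mxE !eqxx/= !mulr1 sub0r -mulrBr mulf_neq0//.
  by move: xi; rewrite !mxE.
- by rewrite !setIT; apply/seteqP; split => y /bdE.
Qed.

(** The centers cancel. In one direction [x + y] is twice the midpoint of [x - c] and [y + c]; in
    the other [z] splits as [(z/2 + c) + (z/2 - c)]. *)
Lemma minkowski_sum_eball c :
  minkowski_sum (eball c 1) (eball (- c) 1) = eball 0 2.
Proof.
apply/seteqP; split => [_ [x xr [y yr <-]]|z zr].
- rewrite /eball/= subr0 in xr yr *.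
  have -> : x + y = 2 *: (2^-1 *: (x - c) + (1 - 2^-1) *: (y - - c)).
    by apply/rowP => i; rewrite !mxE; field.
  rewrite sqnormZ sqnorm_conv.
  have := sqnorm_ge0 (x - c - (y - - c)); nra.
- have zh : sqnorm (2^-1 *: z) <= 1 ^+ 2.
    by rewrite sqnormZ; move: zr; rewrite /eball/= subr0; lra.
  exists (2^-1 *: z + c); first by rewrite /eball/= addrK.
  exists (2^-1 *: z - c); first by rewrite /eball/= opprK subrK.
  by apply/rowP => i; rewrite !mxE; field.
Qed.

End euclidean_ball.

(** * Lebesgue measure on tuples: reflection invariance and volume of cubes *)

Lemma preimage_tcons_measurable (R : realType) n (A : set (n.+1.-tuple R)) :
  measurable A -> measurable (@tcons R n @^-1` A).
Proof. by move=> mA; rewrite -[X in measurable X]setTI; exact: measurable_tcons. Qed.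

Definition tuple_opp (R : realType) (n : nat) (t : n.-tuple R) : n.-tuple R :=
  [tuple - tnth t i | i < n].

Lemma measurable_tuple_opp (R : realType) n :
  measurable_fun [set: n.-tuple R] (@tuple_opp R n).
Proof.
apply/measurable_fun_tnthP => i.
rewrite (_ : _ \o _ = -%R \o (fun t : n.-tuple R => tnth t i)); last first.
  by apply/funext => t /=; rewrite tnth_mktuple.
by apply: measurableT_comp => //; exact: measurable_tnth.
Qed.

Lemma tuple_opp_tcons (R : realType) n (p : measurableTypeR R * n.-tuple R) :
  tuple_opp (tcons p) = tcons (- p.1, tuple_opp p.2).
Proof.
apply: eq_from_tnth => i; rewrite tnth_mktuple /tcons.
case: (unliftP 0 i) => [j ->|->]; last by rewrite !tnth0.
by rewrite !tnthS tnth_mktuple.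
Qed.

Section lebesgue_tuple_opp.
Local Open Scope ereal_scope.
Context (R : realType).

(** Induction on the dimension: the product measure and its image under [phi] agree on rectangles,
    by invariance of each factor, hence everywhere by uniqueness of the product measure. *)
Lemma lebesgue_tuple_opp n (A : set (n.-tuple R)) : measurable A ->
  lebesgue_tuple R n (@tuple_opp R n @^-1` A) = lebesgue_tuple R n A.
Proof.
elim: n A => [A mA|n IH A mA].
  rewrite (_ : @tuple_opp R 0 @^-1` A = A)//.
  by apply/seteqP; split => t /=; rewrite (tuple0 (tuple_opp t)) (tuple0 t).
pose phi (p : measurableTypeR R * n.-tuple R) : measurableTypeR R * n.-tuple R :=
  (- p.1, tuple_opp p.2)%R.
have mphi : measurable_fun setT phi.
  apply/measurable_fun_pair; first exact: measurableT_comp.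
  exact: (measurableT_comp (@measurable_tuple_opp R n)).
have mB := preimage_tcons_measurable mA.
have E : pushforward (@lebesgue_measure R \x lebesgue_tuple R n) phi
    (@tcons R n @^-1` A) = (@lebesgue_measure R \x lebesgue_tuple R n)
    (@tcons R n @^-1` A); last first.
  rewrite /= /lebesgue_succ /pushforward -E /pushforward; congr (_ _).
  by apply/seteqP; split => p /=; rewrite tuple_opp_tcons.
apply/esym/product_measure_unique => //=.
move=> X Y mX mY; rewrite /pushforward/=.
rewrite (_ : phi @^-1` (X `*` Y) = (-%R @^-1` X) `*` (@tuple_opp R n @^-1` Y))//.
have mN : measurable_fun setT (-%R : measurableTypeR R -> measurableTypeR R) by [].
have mX' : measurable ((-%R : measurableTypeR R -> measurableTypeR R) @^-1` X).
  by rewrite -[Z in measurable Z]setTI; exact: mN.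
have mY' : measurable (@tuple_opp R n @^-1` Y).
  by rewrite -[Z in measurable Z]setTI; exact: measurable_tuple_opp.
rewrite product_measure1E// IH//; congr (_ * _).
exact: lebesgue_measureN.
Qed.

Lemma measurable_cube n (A : set (measurableTypeR R)) : measurable A ->
  measurable [set t : n.-tuple R | forall i, A (tnth t i)].
Proof.
move=> mA; rewrite (_ : mkset _ = \bigcap_(i in [set: 'I_n])
    ((fun t : n.-tuple R => tnth t i) @^-1` A)); last first.
  by apply/seteqP; split => [t h i _|t h i]; [exact: h|exact: (h i)].
apply: fin_bigcap_measurable => [|i _]; first exact: finite_finset.
by rewrite -[Z in measurable Z]setTI; exact: measurable_tnth.
Qed.

(** Cubes enclosing, and enclosed in, the punctured ball will show that the sphere has finite,
    positive measure. *)
Lemma lebesgue_tuple_cube n (A : set (measurableTypeR R)) : measurable A ->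
  lebesgue_tuple R n [set t | forall i, A (tnth t i)] =
    lebesgue_measure A ^+ n.
Proof.
move=> mA; elim: n => [|n IH].
  by rewrite expe0 /= diracE mem_set// => -[].
rewrite expeS -IH /= /lebesgue_succ /pushforward.
rewrite -product_measure1E//; last exact: measurable_cube.
congr (_ _); apply/seteqP; split => -[x t] /=.
  move=> h; split; first by have := h ord0; rewrite tnth0.
  by move=> i; have := h (lift ord0 i); rewrite tnthS.
move=> [hx ht] i; case: (unliftP ord0 i) => [j ->|->]; last by rewrite tnth0.
by rewrite tnthS.
Qed.

End lebesgue_tuple_opp.

(** * Spherical measure: finiteness, positivity, antipodal symmetry *)

Section sphere.
Context (R : realType) (n : nat).
Local Notation sigma := (sphere_measure R n).
Local Notation S := (unit_sphere R n).

Lemma enormE (x : 'rV[R]_n) : enorm x = Num.sqrt (sqnorm x).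
Proof. by []. Qed.

Lemma unit_sphereE (t : n.-tuple R) : S t -> sqnorm (to_row t) = 1.
Proof.
by move=> /(congr1 (fun x => x ^+ 2)); rewrite enormE sqr_sqrtr ?sqnorm_ge0// expr1n.
Qed.

Lemma measurable_unit_sphere : measurable S.
Proof.
rewrite (_ : S = (fun t : n.-tuple R => enorm (to_row t)) @^-1` [set 1])//.
by rewrite -[X in measurable X]setTI; exact: measurable_enorm.
Qed.

Lemma to_row_tuple_opp (t : n.-tuple R) : to_row (tuple_opp t) = - to_row t.
Proof. by apply/rowP => i; rewrite !mxE tnth_mktuple. Qed.

Lemma enorm_tuple_opp (t : n.-tuple R) : enorm (to_row (tuple_opp t)) = enorm (to_row t).
Proof.
by rewrite to_row_tuple_opp; congr Num.sqrt; apply: eq_bigr => i _; rewrite mxE sqrrN.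
Qed.

Lemma cone_unit_sphere : punctured_ball R n `&` (@sphere_proj R n) @^-1` S =
  punctured_ball R n.
Proof.
apply/setIidPl => t /andP[t0 _] /=.
rewrite /unit_sphere/= enormE.
have -> : to_row (sphere_proj t) = (enorm (to_row t))^-1 *: to_row t.
  by apply/rowP => i; rewrite !mxE tnth_mktuple.
rewrite sqnormZ sqrtrM ?sqr_ge0// sqrtr_sqr normfV gtr0_norm// -enormE mulVf//.
by rewrite gt_eqF.
Qed.

(** The cone over the sphere is the punctured ball, which lies in the cube [[-1, 1]^n]. *)
Lemma sphere_measure_lty : (sigma S < +oo)%E.
Proof.
rewrite /sphere_measure/= cone_unit_sphere lte_mul_pinfty//.
pose A : set (measurableTypeR R) := `[-1, 1]%classic.
have mA : measurable A by exact: measurable_itv.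
have : (lebesgue_tuple R n (punctured_ball R n) <=
  lebesgue_tuple R n [set t | forall i, A (tnth t i)])%E.
  apply: le_measure; rewrite ?inE.
  - exact: measurable_punctured_ball.
  - exact: measurable_cube.
  move=> t /andP[_ t1] i; rewrite /A/= in_itv/= -ler_norml.
  rewrite -(@ler_sqr _ _ 1) ?nnegrE// real_normK ?num_real// expr1n.
  apply: le_trans (_ : sqnorm (to_row t) <= 1).
    by have := sqr_coord_le_sqnorm (to_row t) i; rewrite mxE.
  by rewrite -[leRHS](expr1n _ 2) -(sqr_sqrtr (sqnorm_ge0 _)) ler_sqr ?nnegrE ?sqrtr_ge0.
move=> /le_lt_trans; apply.
rewrite lebesgue_tuple_cube// /A lebesgue_measure_itv/= lte_fin.
have -> : -1 < 1 :> R by lra.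
by rewrite -EFinB -EFin_expe ltry.
Qed.

Lemma sphere_measure_gt0 : (0 < n)%N -> (0 < sigma S)%E.
Proof.
move=> n0; rewrite /sphere_measure/= cone_unit_sphere mule_gt0// ?lte_fin ?ltr0n//.
(* The cube []0, 1/n]^n] avoids the origin and lies in the unit ball: each [t_i^2 <= t_i <= 1/n], so
   the squares add up to at most 1. *)
pose A : set (measurableTypeR R) := `]0, n%:R^-1]%classic.
have mA : measurable A by exact: measurable_itv.
have : (lebesgue_tuple R n [set t | forall i, A (tnth t i)] <=
  lebesgue_tuple R n (punctured_ball R n))%E.
  apply: le_measure; rewrite ?inE.
  - exact: measurable_cube.
  - exact: measurable_punctured_ball.
  move=> t /= h; rewrite /punctured_ball/= enormE sqrtr_gt0.
  apply/andP; split.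
    apply: sqnorm_gt0; apply/rV0Pn; exists (Ordinal n0).
    by rewrite mxE gt_eqF//; have := h (Ordinal n0); rewrite /A/= in_itv/= => /andP[].
  rewrite -[leRHS]sqrtr1 ler_sqrt//.
  apply: (@le_trans _ _ (\sum_(i < n) n%:R^-1)); last first.
    by rewrite sumr_const card_ord -[X in X <= _]mulr_natr mulVf// pnatr_eq0 -lt0n.
  apply: ler_sum => i _; rewrite mxE.
  have := h i; rewrite /A/= in_itv/= => /andP[t0 tn].
  apply: (le_trans _ tn); rewrite expr2 ger_pMl//.
  apply: (le_trans tn); rewrite invf_le1 ?ltr0n// ler1n//.
apply: lt_le_trans.
rewrite lebesgue_tuple_cube// /A lebesgue_measure_itv/= lte_fin invr_gt0 ltr0n n0.
by rewrite oppr0 addr0 -EFin_expe lte_fin exprn_gt0// invr_gt0 ltr0n.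
Qed.

(** Reflection preserves lengths and commutes with [sphere_proj], so it carries the cone over a set
    to the cone over the opposite set. *)
Lemma sphere_measure_opp (A : set (n.-tuple R)) : measurable A ->
  sigma (@tuple_opp R n @^-1` A) = sigma A.
Proof.
move=> mA; rewrite /sphere_measure/=; congr (_ * _)%E.
rewrite -[RHS]lebesgue_tuple_opp; last first.
  apply: measurableI; first exact: measurable_punctured_ball.
  by rewrite -[X in measurable X]setTI; exact: measurable_sphere_proj.
congr (_ _); apply/seteqP; split => t /=; rewrite /punctured_ball/= enorm_tuple_opp.
  move=> [h At]; split=> //; move: At; congr A.
  by apply: eq_from_tnth => i; rewrite !tnth_mktuple enorm_tuple_opp mulrN.
move=> [h At]; split=> //; move: At; congr A.
by apply: eq_from_tnth => i; rewrite !tnth_mktuple enorm_tuple_opp mulrN.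
Qed.

Lemma Rintegral_sphere_opp (f : n.-tuple R -> R) : measurable_fun S f ->
  (forall t, S t -> 0 <= f t) ->
  \int[sigma]_(t in S) f (tuple_opp t) = \int[sigma]_(t in S) f t.
Proof.
move=> mf f0; rewrite /Rintegral; congr fine.
have SE : @tuple_opp R n @^-1` S = S.
  by apply/seteqP; split => t; rewrite /unit_sphere/= enorm_tuple_opp.
rewrite -[in LHS]SE.
rewrite -(@ge0_integral_pushforward _ _ _ _ R _ (@measurable_tuple_opp R n) sigma S
  (EFin \o f))//.
- apply: eq_measure_integral; first exact: measurable_tuple_opp.
  by move=> ? A mA _; exact: sphere_measure_opp.
- exact: measurable_unit_sphere.
- exact/measurable_EFinP.
- by move=> t /[!inE] tS; rewrite lee_fin f0.
Qed.

Lemma integrable_sphere (f : n.-tuple R -> R) (M : R) : measurable_fun S f ->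
  (forall t, S t -> `|f t| <= M) -> sigma.-integrable S (EFin \o f).
Proof.
move=> mf fM; apply: measurable_bounded_integrable => //.
- exact: measurable_unit_sphere.
- exact: sphere_measure_lty.
- exists M; split; first exact: num_real.
  by move=> x Mx t tS; exact: (le_trans (fM t tS) (ltW Mx)).
Qed.

End sphere.

(** * Radial function of an off-center ball *)

(** The larger root [l] of [l^2 - 2 e a l + e^2 = r^2], the equation saying that [l u] is at
    distance [r] from [e e_i] when [u] is a unit vector with [u_i = a]. *)
Definition ball_radial (R : realType) (e r a : R) : R :=
  e * a + Num.sqrt (r ^+ 2 - e ^+ 2 + e ^+ 2 * a ^+ 2).

Section radial_ball.
Context (R : realType) (n : nat).

Lemma sqnormB_delta (x : 'rV[R]_n) (i : 'I_n) (e : R) :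
  sqnorm (x - e *: delta_mx 0 i) = sqnorm x - 2 * e * x 0 i + e ^+ 2.
Proof.
rewrite /sqnorm (bigD1 i)//= [in RHS](bigD1 i)//=.
rewrite (eq_bigr (fun j => x 0 j ^+ 2)); last first.
  by move=> j /negbTE ji; rewrite !mxE eqxx ji mulr0 subr0.
by rewrite !mxE !eqxx/=; ring.
Qed.

(** The origin is interior when [|e| < r]; the two roots then have opposite signs. *)
Lemma norm_lt_ball_radial_sqrt (e r a : R) : `|e| < r ->
  `|e * a| < Num.sqrt (r ^+ 2 - e ^+ 2 + e ^+ 2 * a ^+ 2).
Proof.
move=> er; have e2 : 0 < r ^+ 2 - e ^+ 2.
  by rewrite subr_gt0 -(real_normK (num_real e)) ltr_sqr ?nnegrE// (le_trans _ (ltW er)).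
rewrite -sqrtr_sqr ltr_sqrt; last by rewrite -exprMn ltr_pwDl// sqr_ge0.
by rewrite exprMn ltrDr.
Qed.

Lemma ball_radial_gt0 (e r a : R) : `|e| < r -> 0 < ball_radial e r a.
Proof.
move=> /(norm_lt_ball_radial_sqrt a).
by rewrite /ball_radial ltr_norml => /andP[]; lra.
Qed.

Lemma radial_eball (i : 'I_n) (e r : R) (t : n.-tuple R) :
  `|e| < r -> unit_sphere R n t ->
  radial (eball (e *: delta_mx 0 i) r) (to_row t) = ball_radial e r (tnth t i).
Proof.
move=> er /unit_sphereE t1; have rho0 := ball_radial_gt0 (tnth t i) er.
(* The admissible [l] fill the interval []0, rho]]: membership reads [(l - e a)^2 <= w^2], and the
   lower root [e a - w] is negative. *)
rewrite /radial -(@sup_itv R (BRight 0) false (ball_radial e r (tnth t i)))//.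
have := norm_lt_ball_radial_sqrt (tnth t i) er.
rewrite {}/ball_radial in rho0 *; set w : R := Num.sqrt _ => aw.
have w0 : 0 <= w by exact: sqrtr_ge0.
have wE : w ^+ 2 = r ^+ 2 - e ^+ 2 + e ^+ 2 * tnth t i ^+ 2.
  by rewrite sqr_sqrtr// ltW// -sqrtr_gt0 (le_lt_trans _ aw).
move: aw; rewrite ltr_norml => /andP[_ aw].
congr sup; apply/seteqP; split => l /=;
  rewrite in_itv/= /eball/= sqnormB_delta sqnormZ t1 mulr1 !mxE.
  move=> [l0 lr]; suff : l - e * tnth t i <= w by rewrite l0/=; lra.
  apply: (le_trans (ler_norm _)); rewrite -(@ler_sqr _ _ w) ?nnegrE//.
  by rewrite real_normK ?num_real// wE; lra.
move=> /andP[l0 lr]; split=> //.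
have : (l - e * tnth t i) ^+ 2 <= w ^+ 2.
  by rewrite -(real_normK (num_real (_ - _))) ler_sqr ?nnegrE// ler_norml; apply/andP; split; lra.
by rewrite wE; lra.
Qed.

End radial_ball.

(** * Numerical gain from a small shift *)

(** With [h = q e^2 / 2] and [T = 1 - 2 (1 + q) e], the product exceeds 2 by
    [2 h (J T - (1 + 2 e) - h (1 + 2 e) J T)]. The bracket is [J - 1] up to three losses, which the
    equation for [e] keeps below [1/4], [1/8] and [1/64] of [J - 1]. *)
Lemma quadratic_gain (R : realType) (q J e : R) : 2 <= q -> 1 < J -> 0 < e ->
  J * e * (8 + 8 * q) = J - 1 ->
  2 < (1 - q / 2 * e ^+ 2 * (1 + 2 * e)) *
    (2 + q * e ^+ 2 * J * (1 - 2 * (1 + q) * e)).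
Proof.
move=> q2 J1 e0 eE.
have Je : e <= J * e by rewrite ler_peMl// ltW.
have qJe : q * e <= J * (q * e) by rewrite ler_peMl ?mulr_ge0 ?(ltW e0) ?(ltW J1)//; lra.
set h := q / 2 * e ^+ 2.
have -> : q * e ^+ 2 * J = 2 * (h * J) by rewrite /h; field.
set T := 1 - 2 * (1 + q) * e.
have h0 : 0 < h by rewrite /h !mulr_gt0 ?exprn_gt0//; lra.
have qe0 : 0 < q * e by rewrite mulr_gt0//; lra.
have e8 : e <= 1 / 8 by nra.
have hle : h <= q * e / 16 by rewrite /h expr2; nra.
have JT : J - (J - 1) / 4 <= J * T by rewrite /T; lra.
have T1 : J * T <= J by rewrite /T; nra.
have e1 : e <= (J - 1) / 16 by nra.
have hJ : h * J <= (J - 1) / 128 by nra.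
have : h * (1 + 2 * e) * (J * T) <= (J - 1) / 64.
  have : h * (J * T) <= h * J by rewrite ler_pM2l.
  have : 0 <= h * (J * T) by rewrite mulr_ge0//; lra.
  nra.
move=> H.
have : 0 < h * (J * T - (1 + 2 * e) - h * (1 + 2 * e) * (J * T)).
  by rewrite mulr_gt0//; lra.
lra.
Qed.

(** * Integrals over the sphere and dual quermassintegrals of balls *)

Section sphere_integrals.
Context (R : realType) (n : nat).
Local Notation sigma := (sphere_measure R n).
Local Notation S := (unit_sphere R n).

Lemma measurable_coord (i : 'I_n) : measurable_fun S (fun t : n.-tuple R => tnth t i).
Proof. by apply: measurable_funTS; exact: measurable_tnth. Qed.

Lemma coord_sqr_le1 (t : n.-tuple R) (i : 'I_n) : S t -> tnth t i ^+ 2 <= 1.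
Proof.
move=> /unit_sphereE <-.
by have := sqr_coord_le_sqnorm (to_row t) i; rewrite mxE.
Qed.

Lemma coord_norm_le1 (t : n.-tuple R) (i : 'I_n) : S t -> `|tnth t i| <= 1.
Proof.
move=> /(coord_sqr_le1 i).
by rewrite -(real_normK (num_real _)) -[leRHS](expr1n _ 2) ler_sqr ?nnegrE.
Qed.

Lemma integrable_coord_sqr (i : 'I_n) :
  sigma.-integrable S (EFin \o (fun t : n.-tuple R => tnth t i ^+ 2)).
Proof.
apply: (@integrable_sphere _ _ _ 1).
  by apply: measurable_funX; exact: measurable_coord.
by move=> t tS; rewrite ger0_norm ?sqr_ge0// coord_sqr_le1.
Qed.

Lemma sum_Rintegral_coord_sqr :
  \sum_(i < n) \int[sigma]_(t in S) (tnth t i ^+ 2) = fine (sigma S).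
Proof.
have mS := @measurable_unit_sphere R n.
transitivity (\int[sigma]_(t in S) (\sum_(i < n) tnth t i ^+ 2)).
  rewrite /Rintegral sum_fine; last first.
    by move=> i _; apply: integrable_fin_num => //; exact: integrable_coord_sqr.
  rewrite -integral_sum//; last by move=> i; exact: integrable_coord_sqr.
  by congr fine; apply: eq_integral => t _; rewrite sumEFin.
rewrite -[RHS]mul1r -Rintegral_cst//; apply: eq_Rintegral => t.
rewrite inE => /unit_sphereE <-; apply: eq_bigr => i _.
by rewrite mxE.
Qed.

(* The n second moments add up to sigma S, so the largest is at least sigma S / n. *)
Lemma second_moment_gt (q : R) : n%:R < q -> (0 < n)%N ->
  exists i : 'I_n, fine (sigma S) < q * \int[sigma]_(t in S) (tnth t i ^+ 2).
Proof.
move=> nq n0; apply/not_existsP => H.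
have s0 : 0 < fine (sigma S).
  by rewrite fine_gt0// sphere_measure_gt0// sphere_measure_lty.
have : q * fine (sigma S) <= n%:R * fine (sigma S).
  rewrite -{1}sum_Rintegral_coord_sqr mulr_sumr -[n in n%:R]card_ord mulr_natl -sumr_const.
  by apply: ler_sum => i _; rewrite leNgt; apply/negP/H.
by rewrite ler_pM2r// leNgt nq.
Qed.

Lemma measurable_ball_radial (i : 'I_n) (e r q : R) :
  measurable_fun S (fun t : n.-tuple R => ball_radial e r (tnth t i) `^ q).
Proof.
have mt := measurable_coord i.
apply: (measurableT_comp (measurable_powR q)); apply: measurable_funD.
  exact: measurable_funM.
apply: (measurableT_comp (continuous_measurable_fun (@sqrt_continuous R))).
apply: measurable_funD => //; apply: measurable_funM => //.
exact: measurable_funX.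
Qed.

(** A crude bound, enough for integrability since the sphere has finite measure. *)
Lemma ball_radial_le (i : 'I_n) (e r q : R) (t : n.-tuple R) :
  `|e| < r -> 0 <= q -> S t ->
  `|ball_radial e r (tnth t i) `^ q| <= (2 * r) `^ q.
Proof.
move=> er q0 tS; rewrite ger0_norm ?powR_ge0//.
have r0 : 0 < r by exact: le_lt_trans er.
have t1 := coord_norm_le1 i tS; have t2 := coord_sqr_le1 i tS.
apply: ge0_ler_powR => //; rewrite ?nnegrE.
- by rewrite ltW// ball_radial_gt0.
- by rewrite mulr_ge0// ltW.
rewrite mulr_natl mulr2n lerD//.
  apply: (le_trans (ler_norm _)); rewrite normrM -[leRHS]mulr1.
  by apply: ler_pM => //; exact: ltW.
rewrite -[leRHS](gtr0_norm r0) -sqrtr_sqr ler_sqrt ?sqr_ge0//.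
have : 0 <= e ^+ 2 * (1 - tnth t i ^+ 2) by rewrite mulr_ge0 ?sqr_ge0// subr_ge0.
lra.
Qed.

Lemma integrable_ball_radial (i : 'I_n) (e r q : R) : `|e| < r -> 0 <= q ->
  sigma.-integrable S (EFin \o (fun t : n.-tuple R => ball_radial e r (tnth t i) `^ q)).
Proof.
move=> er q0; apply: (@integrable_sphere _ _ _ ((2 * r) `^ q)).
  exact: measurable_ball_radial.
by move=> t; exact: ball_radial_le.
Qed.

Lemma dual_quermassintegral_eball (i : 'I_n) (e r q : R) : `|e| < r ->
  dual_quermassintegral q (eball (e *: delta_mx 0 i : 'rV[R]_n) r) =
  n%:R^-1 * \int[sigma]_(t in S) (ball_radial e r (tnth t i) `^ q).
Proof.
move=> er; apply: (f_equal (fun x => n%:R^-1 * x)).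
apply: eq_Rintegral => t; rewrite inE => tS.
by rewrite radial_eball.
Qed.

(** Changing the sign of [e] in [ball_radial] amounts to changing that of [u_i], so the antipodal
    map exchanges the two integrands. *)
Lemma dual_quermassintegral_eballN (i : 'I_n) (e r q : R) : `|e| < r ->
  dual_quermassintegral q (eball (- (e *: delta_mx 0 i) : 'rV[R]_n) r) =
  dual_quermassintegral q (eball (e *: delta_mx 0 i : 'rV[R]_n) r).
Proof.
move=> er; have erN : `|- e| < r by rewrite normrN.
rewrite -scaleNr (dual_quermassintegral_eball i q erN) (dual_quermassintegral_eball i q er).
rewrite -(Rintegral_sphere_opp (measurable_ball_radial i e r q)); last first.
  by move=> t _; exact: powR_ge0.
apply: (f_equal (fun x => n%:R^-1 * x)).
apply: eq_Rintegral => t _; apply: (f_equal (fun x => x `^ q)).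
by rewrite tnth_mktuple /ball_radial !sqrrN mulrN mulNr.
Qed.

Lemma dual_quermassintegral_eball0 (r q : R) : (0 < n)%N -> 0 < r ->
  dual_quermassintegral q (eball (0 : 'rV[R]_n) r) =
  n%:R^-1 * (r `^ q * fine (sigma S)).
Proof.
(* The centered ball is the case [e = 0], along any axis; its radial function is constant. *)
move=> n0 r0; rewrite -(scale0r (delta_mx 0 (Ordinal n0))).
rewrite dual_quermassintegral_eball ?normr0// -Rintegral_cst; last first.
  exact: measurable_unit_sphere.
apply: (f_equal (fun x => n%:R^-1 * x)).
apply: eq_Rintegral => t _; rewrite /ball_radial.
by rewrite mul0r add0r expr0n/= subr0 mul0r addr0 sqrtr_sqr gtr0_norm.
Qed.

Lemma Rintegral_ball_radial_gt (q : R) : (2 <= n)%N -> n%:R < q ->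
  exists (i : 'I_n) (e : R), `|e| < 1 /\
    fine (sigma S) < \int[sigma]_(t in S) (ball_radial e 1 (tnth t i) `^ q).
Proof.
move=> n2 nq; have n0 : (0 < n)%N by exact: leq_trans n2.
have q2 : 2 <= q by rewrite ltW// (le_lt_trans _ nq)// ler_nat.
have q0 : 0 <= q by lra.
have mS := @measurable_unit_sphere R n.
have s0 : 0 < fine (sigma S).
  by rewrite fine_gt0// sphere_measure_gt0// sphere_measure_lty.
have [i Hi] := second_moment_gt nq n0.
set s := fine (sigma S) in s0 Hi *.
set I2 := \int[sigma]_(t in S) _ in Hi.
(* [J] is [q] times the mean of [u_i^2]; [J - 1] is the sign-deciding coefficient of the
   second-order term. *)
pose J := q * I2 / s.
have J1 : 1 < J by rewrite /J ltr_pdivlMr// mul1r.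
have q8 : 0 < 8 + 8 * q by lra.
(* Solves the equation required by [quadratic_gain]; it also gives [(8 + 8 q) e = (J - 1) / J <= 1],
   as [powR_pair_ge] requires. *)
pose e := (J - 1) / (J * (8 + 8 * q)).
have JE : J * e * (8 + 8 * q) = J - 1.
  by rewrite /e; field; rewrite !gt_eqF//; lra.
have e0 : 0 < e by rewrite /e divr_gt0 ?subr_gt0// mulr_gt0//; lra.
have qe : (8 + 8 * q) * e <= 1.
  by rewrite mulrC /e invfM mulrA mulrVK ?unitfE ?gt_eqF// ler_pdivrMr//; lra.
have e1 : `|e| < 1 by rewrite gtr0_norm//; nra.
exists i, e; split => //.
pose D := 1 - q / 2 * e ^+ 2 * (1 + 2 * e).
pose T := 1 - 2 * (1 + q) * e.
set V := \int[sigma]_(t in S) _.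
have iV := integrable_ball_radial i e1 q0.
have e1N : `|- e| < 1 by rewrite normrN.
have iVN := integrable_ball_radial i e1N q0.
have VN : \int[sigma]_(t in S) (ball_radial (- e) 1 (tnth t i) `^ q) = V.
  have := dual_quermassintegral_eballN i q e1; rewrite -scaleNr.
  rewrite (dual_quermassintegral_eball i q e1N) (dual_quermassintegral_eball i q e1).
  apply: mulfI.
  by rewrite invr_eq0 pnatr_eq0 -lt0n.
have i2 := integrable_coord_sqr i.
have icst c : sigma.-integrable S (EFin \o (fun=> c)).
  apply: (@integrable_sphere _ _ _ `|c|) => //.
have iZ c : sigma.-integrable S (EFin \o (fun t : n.-tuple R => c * tnth t i ^+ 2)).
  apply: (@integrable_sphere _ _ _ `|c|) => [|t tS].
    apply: measurable_funM; first exact: measurable_cst.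
    by apply: measurable_funX; exact: measurable_coord.
  rewrite normrM (ger0_norm (sqr_ge0 _)); apply: ler_piMr; first exact: normr_ge0.
  exact: coord_sqr_le1.
(* The pointwise bound of [powR_pair_ge] is integrated over the sphere; by symmetry [rho(u)^q] and
   [rho(-u)^q] both contribute [V]. *)
have : D * (2 * s + q ^+ 2 * e ^+ 2 * T * I2) <= V + V.
  rewrite -[X in _ <= _ + X]VN -(RintegralD mS iV iVN).
  have -> : D * (2 * s + q ^+ 2 * e ^+ 2 * T * I2) =
      \int[sigma]_(t in S) (D * 2 + D * (q ^+ 2 * e ^+ 2 * T) * tnth t i ^+ 2).
    rewrite (RintegralD mS (icst _) (iZ _)) (Rintegral_cst _ mS) (RintegralZl _ mS i2).
    by rewrite -/s -/I2; ring.
  apply: le_Rintegral; first exact: mS.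
  - by have := integrableD mS (icst (D * 2)) (iZ (D * (q ^+ 2 * e ^+ 2 * T))).
  - by have := integrableD mS iV iVN.
  move=> t tS.
  have ta : 0 <= `|tnth t i| <= 1 by rewrite normr_ge0 coord_norm_le1.
  have := powR_pair_ge q2 e0 qe ta.
  rewrite (real_normK (num_real (tnth t i))) -/D -/T /ball_radial sqrrN expr1n.
  set w : R := Num.sqrt _ => H.
  have -> : D * 2 + D * (q ^+ 2 * e ^+ 2 * T) * tnth t i ^+ 2 =
    D * (2 + q ^+ 2 * e ^+ 2 * tnth t i ^+ 2 * T) by ring.
  apply: (le_trans H).
  (* Replacing [u_i] by [|u_i|] at most swaps the two summands. *)
  have [a0|a0] := leP 0 (tnth t i).
    by rewrite (ger0_norm a0) mulNr (addrC w) (addrC w) lexx.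
  by rewrite (ltr0_norm a0) mulNr mulrN opprK (addrC w) (addrC w) [leLHS]addrC lexx.
have qI : q * I2 = J * s by rewrite /J (divfK (lt0r_neq0 s0)).
have -> : q ^+ 2 * e ^+ 2 * T * I2 = q * e ^+ 2 * T * (q * I2) by ring.
have -> : D * (2 * s + q * e ^+ 2 * T * (q * I2)) =
    D * (2 + q * e ^+ 2 * J * T) * s by rewrite qI; ring.
move=> VV; have G := quadratic_gain q2 J1 e0 JE; rewrite -/D -/T in G.
have : 2 * s < D * (2 + q * e ^+ 2 * J * T) * s by rewrite (ltr_pM2r s0).
by move=> /lt_le_trans /(_ VV); clearbody s V; lra.
Qed.

End sphere_integrals.

(** * The counterexample: two opposite shifted unit balls *)

Unset Implicit Arguments.

Theorem theorem1p3 (R : realType) (n : nat) (q : R)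
    (hn : (2 <= n)%N) (hq : n%:R < q) :
  exists K L : set 'rV[R]_n,
    [/\ convex_body K, smooth_boundary K, strictly_convex K & K° 0] /\
    [/\ convex_body L, smooth_boundary L, strictly_convex L & L° 0] /\
    dual_quermassintegral q (minkowski_sum K L) `^ q^-1 <
      dual_quermassintegral q K `^ q^-1 + dual_quermassintegral q L `^ q^-1.
Proof.
have n0 : (0 < n)%N by exact: leq_trans hn.
have q0 : 0 < q by rewrite (le_lt_trans _ hq).
have [i [e [e1 eV]]] := Rintegral_ball_radial_gt hn hq.
pose c : 'rV[R]_n := e *: delta_mx 0 i.
(* [|c|^2 = e^2 < 1] puts the origin in the interior of both balls. *)
have sc : sqnorm c < 1 ^+ 2.
  have := sqnormB_delta 0 i (- e); rewrite scaleNr opprK add0r => ->.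
  rewrite mxE mulr0 subr0 sqrrN /sqnorm big1 ?add0r.
    by rewrite -(real_normK (num_real e)) ltr_sqr ?nnegrE.
  by move=> j _; rewrite mxE expr0n.
have good (d : 'rV[R]_n) : sqnorm d < 1 ^+ 2 ->
    [/\ convex_body (eball d 1), smooth_boundary (eball d 1),
    strictly_convex (eball d 1) & (eball d 1)° 0].
  move=> sd; split; [exact: convex_body_eball|exact: smooth_boundary_eball|
    exact: strictly_convex_eball|].
  by rewrite (eball_interior d ltr01) /= sub0r sqnormN.
exists (eball c 1), (eball (- c) 1); split; first exact: good.
split; first by apply: good; rewrite sqnormN.
rewrite minkowski_sum_eball dual_quermassintegral_eball0//.
rewrite (dual_quermassintegral_eballN i q e1) -[X in _ < X]mulr2n -[X in _ < X]mulr_natl.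
(* The factor [2^q] of the ball of radius 2 leaves the [q]-th root as 2 and cancels the 2 from the
   equal terms on the right, so the unit ball remains to be compared with [K]. *)
rewrite mulrCA powRM ?powR_ge0 ?mulr_ge0 ?invr_ge0 ?fine_ge0//.
rewrite -powRrM mulfV ?gt_eqF// powRr1// ltr_pM2l//.
rewrite (dual_quermassintegral_eball i q e1).
apply: gt0_ltr_powR; rewrite ?invr_gt0 ?nnegrE//.
- by rewrite mulr_ge0 ?invr_ge0 ?fine_ge0.
- rewrite mulr_ge0 ?invr_ge0// (le_trans _ (ltW eV)) ?fine_ge0//.
- by rewrite ltr_pM2l ?invr_gt0 ?ltr0n.
Qed.
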